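(* For every positive integer $r$ and every real $\alpha\ge 1$ there exists a constant $C=C(r,\alpha)$ such that for all positive integers $n,k$ with $n>Ck$, every $\alpha$-irregular intersecting family $\mathcal{F}\subset\binom{[n]}{k}$ satisfies $$|\mathcal{F}|\le C\binom{n-r}{k-r}.$$
   Context: $[n]=\{1,\dots,n\}$ and $\binom{[n]}{k}$ is the set of $k$-element subsets of $[n]$. A family is intersecting if any two of its members intersect. The degree of $x\in[n]$ is the number of members of $\mathcal{F}$ containing $x$. For $\alpha\ge1$, $\mathcal{F}$ is called $\alpha$-irregular if the ratio between the maximal degree and the minimal degree (over all $x\in[n]$) is at most $\alpha$. *)

(* Defs.v *)
From mathcomp Require Import all_boot all_order all_algebra.
From mathcomp Require Import reals.

Set Implicit Arguments.
Unset Strict Implicit.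
Unset Printing Implicit Defensive.

Import Order.TTheory GRing.Theory Num.Theory.
Local Open Scope ring_scope.

(* The ground set {1, .., n} is encoded as 'I_n = {0, .., n - 1}. *)

Definition uniform_family (n k : nat) (F : {set {set 'I_n}}) : Prop :=
  forall A, A \in F -> #|A| = k.

(* A = B is allowed, which only excludes the empty set from F. *)
Definition intersecting (n : nat) (F : {set {set 'I_n}}) : Prop :=
  forall A B, A \in F -> B \in F -> A :&: B != set0.

Definition degree (n : nat) (F : {set {set 'I_n}}) (x : 'I_n) : nat :=
  #|[set A in F | x \in A]|.

Definition max_degree (n : nat) (F : {set {set 'I_n}}) : nat :=
  \max_(x < n) degree F x.

(* #|F| bounds every degree, so for n > 0 this is the true minimum. *)
Definition min_degree (n : nat) (F : {set {set 'I_n}}) : nat :=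
  \big[minn/#|F|]_(x < n) degree F x.

(* The bound max / min <= alpha is multiplied out because x / 0 = 0 here.  A
   family with min = 0 < max (infinite ratio) is therefore not irregular for
   any alpha, while a family with max = min = 0 is. *)
Definition irregular (R : realType) (alpha : R) (n : nat)
    (F : {set {set 'I_n}}) : Prop :=
  (max_degree F)%:R <= alpha * (min_degree F)%:R.

(* The binomial coefficient 'C(n - r, k - r), equal to 0 when k < r; truncated
   subtraction alone would give 'C(n - r, 0) = 1 in that case. *)
Definition bin_shift (n k r : nat) : nat :=
  if (r <= k)%N then 'C(n - r, k - r) else 0%N.

(* Main.v *)
Require Import Defs.
From mathcomp Require Import all_boot all_order all_algebra.
From mathcomp Require Import reals polyrcf ring lra zify.

(* The condition "no bounded set J meets more than half of F" follows from
   irregularity, since every degree is at most alpha k |F| / n.  Let G be the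
   up-closure of F and mu_p the p-biased measure.  If F is large, the members of
   F avoiding J have an up-closure of mu_p-measure at least p^r at some
   p = 4^-m of order k/n (local LYM), hence of mu_{1/4}-measure at least 4^-r,
   because mu_{q^m} <= mu_q^m on up-sets.  On the other hand G is intersecting,
   so mu_{1/2}(G) <= 1/2, and by Russo's formula and the mean value theorem the
   total influence of G is at most 2 at some t in (1/4, 1/2).  Friedgut's junta
   theorem yields a bounded set J carrying almost all of the t-biased Fourier
   weight of the indicator of G.  By monotonicity its conditional expectation
   given J is everywhere at least the measure of the sets A with A \ J in G,
   i.e. at least 4^-r, so it cannot be close to 0-1 valued unless mu_t(G) is
   close to 1: a contradiction. *)

Set Implicit Arguments.
Unset Strict Implicit.
Unset Printing Implicit Defensive.

Import Order.TTheory GRing.Theory Num.Theory.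
Local Open Scope ring_scope.

(** * Biased measures on the power set *)

Lemma prod_mem_eq (R : comPzRingType) (I : finType) (A B : {set I}) :
  \prod_i ((i \in A) == (i \in B))%:R = (A == B)%:R :> R.
Proof.
have [->|neq] := eqVneq A B; first by rewrite big1 // => i _; rewrite eqxx.
have [i Hi] : exists i, (i \in A) != (i \in B).
  apply/existsP; apply: contraR neq; rewrite negb_exists => /forallP H.
  by apply/eqP/setP => i; apply/eqP; rewrite -[_ == _]negbK; apply: H.
by rewrite (bigD1 i) //= (negbTE Hi) mul0r.
Qed.

(** The ring is arbitrary so that [t] may also be the indeterminate ['X], which turns expectations
    into polynomials in the bias. *)
Definition weight (R : comPzRingType) (I : finType) (t : R) (A : {set I}) : R :=
  \prod_i (if i \in A then t else 1 - t).

Definition expect (R : comPzRingType) (I : finType) (t : R)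
    (f : {set I} -> R) : R :=
  \sum_A weight t A * f A.

Lemma eq_expect (R : comPzRingType) (I : finType) (t : R) (f g : {set I} -> R) :
  f =1 g -> expect t f = expect t g.
Proof. by move=> fg; apply: eq_bigr => A _; rewrite fg. Qed.

Lemma expectD (R : comPzRingType) (I : finType) (t : R) (f g : {set I} -> R) :
  expect t (fun A => f A + g A) = expect t f + expect t g.
Proof. by rewrite -big_split; apply: eq_bigr => A _; rewrite mulrDr. Qed.

Lemma expectZ (R : comPzRingType) (I : finType) (t a : R) (f : {set I} -> R) :
  expect t (fun A => a * f A) = a * expect t f.
Proof. by rewrite big_distrr; apply: eq_bigr => A _; rewrite mulrCA. Qed.

Lemma expect_sum (R : comPzRingType) (I J : finType) (t : R) (P : pred J)
    (f : J -> {set I} -> R) :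
  expect t (fun A => \sum_(j | P j) f j A) = \sum_(j | P j) expect t (f j).
Proof.
rewrite exchange_big; apply: eq_bigr => A _.
by rewrite big_distrr.
Qed.

(** Independence of the coordinates: in the expanded product, a term is given by the set of factors
    where the [true] summand is chosen. *)
Lemma expect_prod (R : comPzRingType) (I : finType) (t : R)
    (g : I -> bool -> R) :
  expect t (fun A : {set I} => \prod_i g i (i \in A)) =
  \prod_i (t * g i true + (1 - t) * g i false).
Proof.
rewrite bigA_distr; apply: eq_bigr => A _; rewrite -big_split.
by apply: eq_bigr => i _; case: (i \in A).
Qed.

Lemma expect_cst (R : comPzRingType) (I : finType) (t c : R) :
  expect t (fun _ : {set I} => c) = c.
Proof.
rewrite (@eq_expect _ _ _ _ (fun A : {set I} => c * \prod_(i : I) 1)); last first.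
  by move=> A; rewrite big1 ?mulr1.
rewrite expectZ (expect_prod t (fun _ _ => 1)) big1 ?mulr1 // => i _.
by ring.
Qed.

Lemma weight_ge0 (R : realFieldType) (I : finType) (t : R) (A : {set I}) :
  0 <= t <= 1 -> 0 <= weight t A.
Proof. by move=> /andP[? ?]; apply: prodr_ge0 => i _; case: ifP; lra. Qed.

Lemma le_expect (R : realFieldType) (I : finType) (t : R) (f g : {set I} -> R) :
  0 <= t <= 1 -> (forall A, f A <= g A) -> expect t f <= expect t g.
Proof.
by move=> t01 fg; apply: ler_sum => A _; apply: ler_wpM2l; rewrite ?weight_ge0.
Qed.

Lemma expect_ge0 (R : realFieldType) (I : finType) (t : R) (f : {set I} -> R) :
  0 <= t <= 1 -> (forall A, 0 <= f A) -> 0 <= expect t f.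
Proof. by move=> t01 f0; rewrite -[0](expect_cst I t); apply: le_expect. Qed.

Lemma sum_set_split (R : nmodType) (I : finType) (i : I) (P : pred {set I})
    (F : {set I} -> R) :
  \sum_(A | P A) F A =
  \sum_(A : {set I} | i \notin A) ((if P A then F A else 0) +
                         (if P (i |: A) then F (i |: A) else 0)).
Proof.
rewrite big_mkcond (bigID (fun A : {set I} => i \notin A)) /= big_split /=.
congr (_ + _); rewrite (reindex_onto (fun A => i |: A) (fun A => A :\ i)) /=.
  apply: eq_bigl => A; rewrite negbK setU11 /=.
  apply/eqP/idP => [<-|iA]; first by rewrite setD11.
  exact: setU1K.
by move=> A; rewrite negbK; apply: setD1K.
Qed.

(** Fubini in the coordinate [i]: the sets are grouped into pairs [A], [i |: A] with [i] outside
    [A], whose weights differ in one factor only. *)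
Lemma expect_resample (R : comPzRingType) (I : finType) (t : R) (i : I)
    (f : {set I} -> R) :
  expect t f = expect t (fun A => t * f (i |: A) + (1 - t) * f (A :\ i)).
Proof.
rewrite /expect !(sum_set_split i xpredT) /=; apply: eq_bigr => A iA.
have -> : (i |: A) :\ i = A by apply: setU1K.
have -> : A :\ i = A by apply/setDidPl; rewrite disjoint_sym disjoints1.
have -> : i |: (i |: A) = i |: A by rewrite setUA setUid.
have wD B : weight t B = (if i \in B then t else 1 - t) *
    \prod_(j | j != i) (if j \in B then t else 1 - t).
  by rewrite /weight (bigD1 i).
rewrite !wD setU11 (negbTE iA).
rewrite (_ : \prod_(j | j != i) (if j \in i |: A then t else 1 - t) =
             \prod_(j | j != i) (if j \in A then t else 1 - t)); last first.
  by apply: eq_bigr => j /negbTE ji; rewrite !inE ji.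
by ring.
Qed.

Lemma cauchy_schwarz (R : realFieldType) (I : finType) (t : R)
    (f g : {set I} -> R) :
  0 <= t <= 1 ->
  expect t (fun A => f A * g A) ^+ 2 <=
  expect t (fun A => f A ^+ 2) * expect t (fun A => g A ^+ 2).
Proof.
move=> t01; set a := expect t (fun A => f A ^+ 2).
set b := expect t (fun A => g A ^+ 2); set c := expect t _.
have quad x : 0 <= a - 2 * x * c + x ^+ 2 * b.
  rewrite (_ : _ + _ = expect t (fun A => (f A - x * g A) ^+ 2)); last first.
    rewrite (@eq_expect _ _ _ _ (fun A => f A ^+ 2 +
      ((- (2 * x)) * (f A * g A) + x ^+ 2 * g A ^+ 2))); last first.
      by move=> A; ring.
    by rewrite !expectD !expectZ -/a -/b -/c; ring.
  by apply: expect_ge0 => // A; rewrite sqr_ge0.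
have a0 : 0 <= a by apply: expect_ge0 => // A; rewrite sqr_ge0.
have b0 : 0 <= b by apply: expect_ge0 => // A; rewrite sqr_ge0.
(* For [b = 0] the quadratic is affine in [x]; unless [c = 0], the value [x = (a + 1) / (2 * c)]
   makes it [-1]. Otherwise its minimum, at [x = c / b], is used. *)
have [bz|bnz] := eqVneq b 0.
  have [->|cnz] := eqVneq c 0; first by rewrite expr0n mulr_ge0.
  have := quad ((a + 1) / (2 * c)); rewrite bz mulr0 addr0.
  have -> : 2 * ((a + 1) / (2 * c)) * c = a + 1 by field.
  lra.
have := quad (c / b).
have -> : a - 2 * (c / b) * c + (c / b) ^+ 2 * b = (a * b - c ^+ 2) / b by field.
have b1 : 0 < b by rewrite lt_def bnz.
by rewrite pmulr_lge0 ?invr_gt0 // subr_ge0.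
Qed.

(** * Biased Fourier analysis *)

Definition stdev (R : rcfType) (t : R) : R := Num.sqrt (t * (1 - t)).

(** For [0 < t < 1], the coordinate normalised to mean 0 and variance 1; its products [chi] are the
    orthonormal basis of the biased Fourier expansion. *)
Definition phi (R : rcfType) (t : R) (b : bool) : R := (b%:R - t) / stdev t.

Definition chi (R : rcfType) (I : finType) (t : R) (S A : {set I}) : R :=
  \prod_(i in S) phi t (i \in A).

Definition coef (R : rcfType) (I : finType) (t : R) (f : {set I} -> R)
    (S : {set I}) : R :=
  expect t (fun A => f A * chi t S A).

Lemma stdev_gt0 (R : rcfType) (t : R) : 0 < t < 1 -> 0 < stdev t.
Proof. by move=> /andP[? ?]; rewrite sqrtr_gt0 mulr_gt0 ?subr_gt0. Qed.

Lemma stdev_sqr (R : rcfType) (t : R) : 0 < t < 1 -> stdev t ^+ 2 = t * (1 - t).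
Proof.
by move=> /andP[? ?]; rewrite sqr_sqrtr // mulr_ge0 ?subr_ge0 // ltW.
Qed.

Lemma phiM (R : rcfType) (t : R) (b c : bool) : 0 < t < 1 ->
  phi t b * phi t c = (b%:R - t) * (c%:R - t) / (t * (1 - t)).
Proof.
move=> t01; rewrite -stdev_sqr // /phi.
by have := stdev_gt0 t01 => s0; field; rewrite gt_eqF.
Qed.

Lemma expect_chiM (R : rcfType) (I : finType) (t : R) (S T : {set I}) :
  0 < t < 1 -> expect t (fun A => chi t S A * chi t T A) = (S == T)%:R.
Proof.
move=> t01; have s0 := stdev_gt0 t01.
pose g i b := (if i \in S then phi t b else 1) * (if i \in T then phi t b else 1).
rewrite (@eq_expect _ _ _ _ (fun A => \prod_i g i (i \in A))); last first.
  by move=> A; rewrite /chi big_mkcond [X in _ * X]big_mkcond -big_split.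
rewrite expect_prod.
have [/andP[t0 t1]] := (t01, t01).
have ge i : t * g i true + (1 - t) * g i false = ((i \in S) == (i \in T))%:R.
  rewrite /g; case: (i \in S); case: (i \in T); rewrite /= ?mul1r ?mulr1 ?phiM //.
  - by rewrite /=; field; rewrite subr_eq0 !gt_eqF.
  - by rewrite /phi /=; field; rewrite gt_eqF.
  - by rewrite /phi /=; field; rewrite gt_eqF.
  - by ring.
by rewrite (eq_bigr _ (fun i _ => ge i)) prod_mem_eq.
Qed.

Lemma chi0 (R : rcfType) (I : finType) (t : R) (A : {set I}) : chi t set0 A = 1.
Proof. by rewrite /chi big_set0. Qed.

Lemma chiU1 (R : rcfType) (I : finType) (t : R) (i : I) (S A : {set I}) :
  i \notin S -> chi t (i |: S) A = phi t (i \in A) * chi t S A.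
Proof. exact: big_setU1. Qed.

Lemma expect_chi (R : rcfType) (I : finType) (t : R) (S : {set I}) :
  0 < t < 1 -> expect t (chi t S) = (S == set0)%:R.
Proof.
move=> t01; rewrite -(expect_chiM S set0 t01); apply: eq_expect => A.
by rewrite chi0 mulr1.
Qed.

Lemma expect_fourierM (R : rcfType) (I : finType) (t : R) (a b : {set I} -> R) :
  0 < t < 1 ->
  expect t (fun A => (\sum_S a S * chi t S A) * (\sum_S b S * chi t S A)) =
  \sum_S a S * b S.
Proof.
move=> t01.
rewrite (@eq_expect _ _ _ _ (fun A =>
   \sum_S \sum_T a S * b T * (chi t S A * chi t T A))); last first.
  move=> A; rewrite big_distrl; apply: eq_bigr => S _; rewrite big_distrr.
  by apply: eq_bigr => T _ /=; ring.
rewrite expect_sum; apply: eq_bigr => S _; rewrite expect_sum (bigD1 S) //=.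
rewrite expectZ expect_chiM // eqxx mulr1 big1 ?addr0 // => T TS.
by rewrite expectZ expect_chiM // eq_sym (negbTE TS) mulr0.
Qed.

(** Completeness of the characters: the kernel factors over the coordinates, and the factor at [i]
    vanishes when [A] and [B] differ at [i] and otherwise cancels the weight. *)
Lemma fourier (R : rcfType) (I : finType) (t : R) (f : {set I} -> R)
    (A : {set I}) :
  0 < t < 1 -> f A = \sum_S coef t f S * chi t S A.
Proof.
move=> t01; have /andP[t0 t1] := t01.
have kernel B : weight t B * (\sum_S chi t S B * chi t S A) = (A == B)%:R.
  have -> : \sum_S chi t S B * chi t S A =
            \prod_i (phi t (i \in B) * phi t (i \in A) + 1).
    rewrite bigA_distr; apply: eq_bigr => S _.
    by rewrite /chi big_mkcond [X in _ * X]big_mkcond -big_split;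
       apply: eq_bigr => i _ /=; case: (i \in S); rewrite ?mulr1.
  rewrite -big_split /=.
  have ge i : (if i \in B then t else 1 - t) *
      (phi t (i \in B) * phi t (i \in A) + 1) = ((i \in A) == (i \in B))%:R.
    by rewrite phiM //; case: (i \in A); case: (i \in B) => /=;
      field; rewrite subr_eq0 !gt_eqF.
  by rewrite (eq_bigr _ (fun i _ => ge i)) prod_mem_eq.
transitivity (\sum_B f B * (weight t B * (\sum_S chi t S B * chi t S A))).
  rewrite (bigD1 A) //= kernel eqxx mulr1 big1 ?addr0 // => B BA.
  by rewrite kernel eq_sym (negbTE BA) mulr0.
transitivity (\sum_B \sum_S weight t B * (f B * chi t S B) * chi t S A).
  apply: eq_bigr => B _; rewrite mulrA big_distrr /=.
  by apply: eq_bigr => S _; ring.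
by rewrite exchange_big; apply: eq_bigr => S _; rewrite /coef /expect big_distrl.
Qed.

Lemma expectM_fourier (R : rcfType) (I : finType) (t : R)
    (f : {set I} -> R) (a : {set I} -> R) : 0 < t < 1 ->
  expect t (fun A => f A * (\sum_S a S * chi t S A)) = \sum_S coef t f S * a S.
Proof.
move=> t01; rewrite -(expect_fourierM _ _ t01).
by apply: eq_expect => A; rewrite -(fourier f A t01).
Qed.

Lemma parseval (R : rcfType) (I : finType) (t : R) (f : {set I} -> R) :
  0 < t < 1 -> expect t (fun A => f A ^+ 2) = \sum_S coef t f S ^+ 2.
Proof.
move=> t01; rewrite (eq_bigr _ (fun S _ => expr2 (coef t f S))) -expectM_fourier //.
by apply: eq_expect => A; rewrite -(fourier f A t01) expr2.
Qed.

Lemma coef_fourier (R : rcfType) (I : finType) (t : R) (a : {set I} -> R)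
    (S : {set I}) :
  0 < t < 1 -> coef t (fun A => \sum_T a T * chi t T A) S = a S.
Proof.
move=> t01; rewrite /coef (@eq_expect _ _ _ _ (fun A =>
   \sum_T a T * (chi t T A * chi t S A))); last first.
  by move=> A; rewrite big_distrl; apply: eq_bigr => T _ /=; ring.
rewrite expect_sum (bigD1 S) //= expectZ expect_chiM // eqxx mulr1.
rewrite big1 ?addr0 // => T TS.
by rewrite expectZ expect_chiM // (negbTE TS) mulr0.
Qed.

(** * Hypercontractivity *)

Lemma chi_setI (R : rcfType) (I : finType) (t : R) (S A B : {set I}) :
  A :&: S = B :&: S -> chi t S A = chi t S B.
Proof.
move=> AB; apply: eq_bigr => i iS; congr phi.
by have /setP/(_ i) := AB; rewrite !inE iS !andbT.
Qed.

Lemma chi_setU1 (R : rcfType) (I : finType) (t : R) (i : I) (S A : {set I}) :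
  i \notin S -> chi t S (i |: A) = chi t S A.
Proof.
move=> iS; apply: chi_setI; apply/setP => j; rewrite !inE.
by case: eqVneq => // ->; rewrite (negbTE iS) !andbF.
Qed.

Lemma chi_setD1 (R : rcfType) (I : finType) (t : R) (i : I) (S A : {set I}) :
  i \notin S -> chi t S (A :\ i) = chi t S A.
Proof.
move=> iS; apply: chi_setI; apply/setP => j; rewrite !inE.
by case: eqVneq => // ->; rewrite (negbTE iS) !andbF.
Qed.

(** The right side is [(a ^+ 2 + b ^+ 2) ^+ 2], left expanded so that its terms can be bounded
    separately in an induction. The range of [t] keeps the third and fourth moments of [phi]
    bounded. *)
Lemma two_point_hypercontractive (R : rcfType) (t a b : R) :
  4^-1 <= t <= 2^-1 ->
  t * (a + 2^-1 * phi t true * b) ^+ 4 + (1 - t) * (a + 2^-1 * phi t false * b) ^+ 4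
  <= a ^+ 4 + 2 * (a ^+ 2 * b ^+ 2) + b ^+ 4.
Proof.
move=> /andP[t1 t2].
have t01 : 0 < t < 1 by apply/andP; split; lra.
have s0 := stdev_gt0 t01; have ss := stdev_sqr t01.
set s := stdev t in s0 ss.
have v0 : 3 / 16 <= t * (1 - t) by nra.
(* Third and fourth moments of [phi]; the bounds below are attained at [t = 4^-1]. *)
pose m3 := (1 - 2 * t) / s; pose m4 := (1 - 3 * (t * (1 - t))) / (t * (1 - t)).
have s4 : s ^+ 4 = (t * (1 - t)) ^+ 2 by rewrite -ss; ring.
have m3s : m3 ^+ 2 <= 4 / 3.
  rewrite /m3 expr_div_n ss ler_pdivrMr; last by lra.
  by nra.
have m4s : m4 <= 7 / 3.
  by rewrite /m4 ler_pdivrMr; lra.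
have m3E : t * phi t true ^+ 3 + (1 - t) * phi t false ^+ 3 = m3.
  rewrite /phi /= -/s /m3.
  rewrite (_ : _ + _ = (t * (1 - t)) * (1 - 2 * t) / s ^+ 3); last first.
    by field; rewrite gt_eqF.
  by rewrite -ss; field; rewrite gt_eqF.
have m4E : t * phi t true ^+ 4 + (1 - t) * phi t false ^+ 4 = m4.
  rewrite /phi /= -/s /m4.
  rewrite (_ : _ + _ = (t * (1 - t)) * (1 - 3 * (t * (1 - t))) / s ^+ 4); last first.
    by field; rewrite gt_eqF.
  by rewrite s4; field; rewrite subr_eq0 !gt_eqF //; lra.
have m1E : t * phi t true + (1 - t) * phi t false = 0.
  by rewrite /phi /= -/s; field; rewrite gt_eqF.
have m2E : t * phi t true ^+ 2 + (1 - t) * phi t false ^+ 2 = 1.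
  rewrite /phi /= -/s.
  rewrite (_ : _ + _ = (t * (1 - t)) / s ^+ 2); last by field; rewrite gt_eqF.
  by rewrite ss divff // gt_eqF //; lra.
rewrite (_ : _ + _ = a ^+ 4
  + 2 * a ^+ 3 * b * (t * phi t true + (1 - t) * phi t false)
  + 3 / 2 * a ^+ 2 * b ^+ 2 * (t * phi t true ^+ 2 + (1 - t) * phi t false ^+ 2)
  + 2^-1 * a * b ^+ 3 * (t * phi t true ^+ 3 + (1 - t) * phi t false ^+ 3)
  + 16^-1 * b ^+ 4 * (t * phi t true ^+ 4 + (1 - t) * phi t false ^+ 4));
  last by field.
rewrite m1E m2E m3E m4E.
(* This square absorbs the cross term in [a * b ^+ 3]. *)
have : 0 <= b ^+ 2 * (a - 2^-1 * b * m3) ^+ 2 by rewrite mulr_ge0 ?sqr_ge0.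
have : b ^+ 4 * m3 ^+ 2 <= b ^+ 4 * (4 / 3).
  by apply: ler_wpM2l => //; rewrite (exprM b 2 2) sqr_ge0.
have : b ^+ 4 * m4 <= b ^+ 4 * (7 / 3).
  by apply: ler_wpM2l => //; rewrite (exprM b 2 2) sqr_ge0.
have : 0 <= b ^+ 4 by rewrite (exprM b 2 2) sqr_ge0.
have -> : b ^+ 2 * (a - 2^-1 * b * m3) ^+ 2 =
  a ^+ 2 * b ^+ 2 - a * b ^+ 3 * m3 + 4^-1 * (b ^+ 4 * m3 ^+ 2) by field.
lra.
Qed.

Lemma sum_subset_split (R : nmodType) (I : finType) (i : I) (U : {set I})
    (F : {set I} -> R) :
  i \in U ->
  \sum_(S : {set I} | S \subset U) F S =
  \sum_(S : {set I} | S \subset U :\ i) F S +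
  \sum_(S : {set I} | S \subset U :\ i) F (i |: S).
Proof.
move=> iU; rewrite (sum_set_split i) -big_split /=.
rewrite big_mkcond [RHS]big_mkcond; apply: eq_bigr => S _.
rewrite subsetD1 subUset sub1set iU andbC.
by case: (i \in S) => //=; case: (S \subset U); rewrite ?addr0.
Qed.

(** Bonami's inequality between the second and fourth moments, by induction on [U]: the sum is
    affine in [phi] at a chosen [i], so the two-point inequality applies with the other coordinates
    fixed. *)
Lemma bonami (R : rcfType) (I : finType) (t : R) (U : {set I})
    (c : {set I} -> R) :
  4^-1 <= t <= 2^-1 ->
  expect t (fun A =>
    (\sum_(S : {set I} | S \subset U) 2^-1 ^+ #|S| * c S * chi t S A) ^+ 4) <=
  (\sum_(S : {set I} | S \subset U) c S ^+ 2) ^+ 2.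
Proof.
move=> t12; have t01 : 0 <= t <= 1 by move: t12 => /andP[? ?]; apply/andP; split; lra.
have [n] := ubnP #|U|; elim: n => // n IH in U c *; rewrite ltnS => Un.
have [->|[i iU]] := set_0Vmem U.
  rewrite (eq_bigl _ _ (@subset0 I)) big_pred1_eq.
  rewrite (@eq_expect _ _ _ _ (fun _ : {set I} => c set0 ^+ 4)).
    by rewrite expect_cst -exprM.
  move=> A; rewrite (eq_bigl _ _ (@subset0 I)) big_pred1_eq.
  by rewrite chi0 cards0 mul1r mulr1.
pose a A := \sum_(S : {set I} | S \subset U :\ i) 2^-1 ^+ #|S| * c S * chi t S A.
pose b A := \sum_(S : {set I} | S \subset U :\ i)
  2^-1 ^+ #|S| * c (i |: S) * chi t S A.
have decomp A : \sum_(S : {set I} | S \subset U) 2^-1 ^+ #|S| * c S * chi t S A =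
    a A + 2^-1 * phi t (i \in A) * b A.
  rewrite (sum_subset_split _ iU); congr (_ + _); rewrite /b big_distrr /=.
  apply: eq_bigr => S; rewrite subsetD1 => /andP[_ iS].
  by rewrite chiU1 // cardsU1 iS exprS; ring.
have invU A : a (i |: A) = a A /\ b (i |: A) = b A.
  by split; apply: eq_bigr => S; rewrite subsetD1 => /andP[_ iS];
     rewrite chi_setU1.
have invD A : a (A :\ i) = a A /\ b (A :\ i) = b A.
  by split; apply: eq_bigr => S; rewrite subsetD1 => /andP[_ iS];
     rewrite chi_setD1.
rewrite (@eq_expect _ _ _ _ (fun A => (a A + 2^-1 * phi t (i \in A) * b A) ^+ 4));
  last by move=> A; rewrite decomp.
rewrite (expect_resample _ i) (sum_subset_split _ iU).
set X := \sum_(_ | _) _; set Y := \sum_(_ | _) _.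
have card_lt : (#|U :\ i| < n)%N by move: Un; rewrite (cardsD1 i U) iU.
have aX : expect t (fun A => a A ^+ 4) <= X ^+ 2 by apply: IH.
have bY : expect t (fun A => b A ^+ 4) <= Y ^+ 2.
  by apply: (IH _ (fun S => c (i |: S))).
have X0 : 0 <= X by apply: sumr_ge0 => S _; rewrite sqr_ge0.
have Y0 : 0 <= Y by apply: sumr_ge0 => S _; rewrite sqr_ge0.
(* Mixed term: Cauchy-Schwarz followed by both induction hypotheses. *)
have abXY : expect t (fun A => a A ^+ 2 * b A ^+ 2) <= X * Y.
  rewrite -ler_sqr ?nnegrE ?mulr_ge0 //; last first.
    by apply: expect_ge0 => // A; rewrite mulr_ge0 ?sqr_ge0.
  apply: (le_trans (cauchy_schwarz _ _ t01)); rewrite exprMn.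
  have e4 (f : {set I} -> R) : expect t (fun A => (f A ^+ 2) ^+ 2) =
      expect t (fun A => f A ^+ 4) by apply: eq_expect => A; rewrite -exprM.
  rewrite !e4; apply: ler_pM => //; apply: expect_ge0 => // A;
    by rewrite (exprM _ 2 2) sqr_ge0.
apply: (@le_trans _ _
  (expect t (fun A => a A ^+ 4 + 2 * (a A ^+ 2 * b A ^+ 2) + b A ^+ 4))).
  apply: le_expect => // A; rewrite setU11 setD11.
  have [-> ->] := invU A; have [-> ->] := invD A.
  exact: two_point_hypercontractive.
rewrite !expectD expectZ sqrrD.
by move: aX bY abXY; lra.
Qed.

(** * Influences and juntas *)

(** Discrete derivative; for the indicator of an up-set it is 1 where [i] is pivotal and 0
    elsewhere. *)
Definition diff (R : pzRingType) (I : finType) (f : {set I} -> R) (i : I)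
    (A : {set I}) : R :=
  f (i |: A) - f (A :\ i).

Definition influence (R : comPzRingType) (I : finType) (t : R)
    (f : {set I} -> R) (i : I) : R :=
  expect t (diff f i).

(** Averaging [f] times [phi] over the coordinate [i] gives [stdev t] times [diff f i]. *)
Lemma coef_diff (R : rcfType) (I : finType) (t : R) (f : {set I} -> R) (i : I)
    (S : {set I}) :
  0 < t < 1 -> i \notin S ->
  coef t (diff f i) S = coef t f (i |: S) / stdev t.
Proof.
move=> t01 iS; have s0 := stdev_gt0 t01; have ss := stdev_sqr t01.
rewrite /coef [X in _ = X / _](expect_resample _ i) [RHS]mulrC -expectZ.
apply: eq_expect => A; rewrite !chiU1 // setU11 setD11.
rewrite chi_setU1 // chi_setD1 // /phi /diff /=.
rewrite [X in _ = _ * X](_ : _ = t * (1 - t) / stdev t * ((f (i |: A) - f (A :\ i)) * chi t S A)).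
  by rewrite -ss; field; rewrite gt_eqF.
by field; rewrite gt_eqF.
Qed.

(** [diff f i] does not depend on the coordinate [i], and [phi] has mean 0. *)
Lemma coef_diff_eq0 (R : rcfType) (I : finType) (t : R) (f : {set I} -> R)
    (i : I) (S : {set I}) :
  0 < t < 1 -> i \in S -> coef t (diff f i) S = 0.
Proof.
move=> t01 iS; have s0 := stdev_gt0 t01.
rewrite /coef (expect_resample _ i) -[RHS](expect_cst I t).
apply: eq_expect => A; rewrite /diff.
have -> : i |: (i |: A) = i |: A by rewrite setUA setUid.
have -> : i |: (A :\ i) = i |: A by apply/setP => j; rewrite !inE; case: eqVneq.
have -> : (i |: A) :\ i = A :\ i by apply/setP => j; rewrite !inE; case: eqVneq.
have -> : (A :\ i) :\ i = A :\ i by rewrite setDDl setUid.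
rewrite -[in chi t S (i |: A)](setD1K iS) -[in chi t S (A :\ i)](setD1K iS).
rewrite !chiU1 ?setD11 // setU11.
rewrite chi_setU1 ?setD11 // chi_setD1 ?setD11 //.
by rewrite /phi /=; field; rewrite gt_eqF.
Qed.

Lemma sum_set_mem (R : nmodType) (I : finType) (i : I) (F : {set I} -> R) :
  \sum_(S : {set I} | i \in S) F S = \sum_(S : {set I} | i \notin S) F (i |: S).
Proof.
rewrite (sum_set_split i); apply: eq_bigr => S iS.
by rewrite setU11 (negbTE iS) add0r.
Qed.

(** Meant for [a = 1], where Parseval evaluates the right side, and for the noise [a = 4^-1]. The
    extra factor [a] comes from [#|i |: S| = #|S| + 1]. *)
Lemma sum_coef_diff (R : rcfType) (I : finType) (t a : R) (f : {set I} -> R)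
    (i : I) :
  0 < t < 1 ->
  \sum_(S : {set I} | i \in S) a ^+ #|S| * coef t f S ^+ 2 =
  t * (1 - t) * a * \sum_(S : {set I}) a ^+ #|S| * coef t (diff f i) S ^+ 2.
Proof.
move=> t01; have s0 := stdev_gt0 t01.
rewrite sum_set_mem [in RHS](bigID (fun S : {set I} => i \in S)) /=.
rewrite [X in _ * (X + _)]big1; last first.
  by move=> S iS; rewrite coef_diff_eq0 // expr0n mulr0.
rewrite add0r big_distrr; apply: eq_bigr => S iS /=.
by rewrite coef_diff // cardsU1 iS add1n [a ^+ _.+1]exprS -stdev_sqr //; field; rewrite gt_eqF.
Qed.

(** Dual use of hypercontractivity: with [s] the left side and [P] the mean of [g], two applications
    of Cauchy-Schwarz in place of Hoelder's inequality give [s ^+ 2 <= P ^+ 3], hence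
    [s <= delta * P]. *)
Lemma small_support_noise (R : rcfType) (I : finType) (t delta : R)
    (g : {set I} -> R) :
  4^-1 <= t <= 2^-1 -> 0 <= delta -> (forall A, g A ^+ 2 = g A) ->
  expect t g <= delta ^+ 2 ->
  \sum_(S : {set I}) 4^-1 ^+ #|S| * coef t g S ^+ 2 <= delta * expect t g.
Proof.
move=> t12 d0 gg Pd.
have t01 : 0 < t < 1 by move: t12 => /andP[? ?]; apply/andP; split; lra.
have t01' : 0 <= t <= 1 by move: t01 => /andP[? ?]; apply/andP; split; lra.
pose c (S : {set I}) := 2^-1 ^+ #|S| * coef t g S.
(* [u] is [g] with the noise operator of rate 1/2 applied twice. *)
pose u A := \sum_(S : {set I}) 2^-1 ^+ #|S| * c S * chi t S A.
have cE (S : {set I}) : 4^-1 ^+ #|S| * coef t g S ^+ 2 = c S ^+ 2.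
  rewrite /c exprMn -exprM mulnC exprM; congr (_ ^+ _ * _); by field.
rewrite (eq_bigr _ (fun S _ => cE S)); set s := \sum_S _; set P := expect t g in Pd *.
have s0 : 0 <= s by apply: sumr_ge0 => S _; rewrite sqr_ge0.
have P0 : 0 <= P by apply: expect_ge0 => // A; rewrite -gg sqr_ge0.
have u4 : expect t (fun A => u A ^+ 4) <= s ^+ 2.
  have := bonami setT c t12; rewrite (eq_bigl xpredT _ (@subsetT I)).
  congr (_ <= _); apply: eq_expect => A.
  by rewrite (eq_bigl xpredT _ (@subsetT I)).
have gu : expect t (fun A => g A * u A) = s.
  rewrite expectM_fourier //; apply: eq_bigr => S _; rewrite /c; ring.
have Pg : expect t (fun A => g A ^+ 2) = P by apply: eq_expect.
pose Q := expect t (fun A => g A * u A ^+ 2).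
have sPQ : s ^+ 2 <= P * Q.
  have := cauchy_schwarz g (fun A => g A * u A) t01'.
  rewrite Pg (@eq_expect _ _ _ _ (fun A => g A * u A)); last first.
    by move=> A; rewrite mulrA -expr2 gg.
  rewrite gu (@eq_expect _ _ _ (fun A => (g A * u A) ^+ 2)
    (fun A => g A * u A ^+ 2)) //.
  by move=> A; rewrite exprMn gg.
have Q0 : 0 <= Q by apply: expect_ge0 => // A; rewrite -gg mulr_ge0 ?sqr_ge0.
have QP : Q ^+ 2 <= P * s ^+ 2.
  have := cauchy_schwarz g (fun A => u A ^+ 2) t01'; rewrite Pg => /le_trans; apply.
  rewrite (@eq_expect _ _ _ (fun A => (u A ^+ 2) ^+ 2) (fun A => u A ^+ 4)).
    by apply: ler_wpM2l.
  by move=> A; rewrite -exprM.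
have [-> |sn0] := eqVneq s 0; first exact: mulr_ge0.
have s2 : 0 < s ^+ 2 by rewrite exprn_gt0 // lt_def sn0.
rewrite -ler_sqr ?nnegrE ?mulr_ge0 // -(ler_pM2r s2).
have : (s ^+ 2) ^+ 2 <= (P * Q) ^+ 2 by rewrite ler_sqr ?nnegrE ?mulr_ge0 // sqr_ge0.
rewrite -expr2 => /le_trans; apply.
rewrite exprMn; apply: (@le_trans _ _ (P ^+ 2 * (P * s ^+ 2))).
  by apply: ler_wpM2l; rewrite ?sqr_ge0.
rewrite (_ : (delta * P) ^+ 2 * s ^+ 2 = P ^+ 2 * (delta ^+ 2 * s ^+ 2)); last by ring.
apply: ler_wpM2l; rewrite ?sqr_ge0 //; apply: ler_wpM2r => //.
exact: ltW.
Qed.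

(* Friedgut's junta theorem: beyond level [d] the total influence controls the
   Fourier weight, and below it hypercontractivity does. *)
Lemma friedgut_junta (R : rcfType) (I : finType) (t delta : R) (d : nat)
    (f : {set I} -> R) (J : {set I}) :
  4^-1 <= t <= 2^-1 -> 0 <= delta -> (0 < d)%N ->
  (forall i A, diff f i A ^+ 2 = diff f i A) ->
  (forall i, i \notin J -> influence t f i <= delta ^+ 2) ->
  \sum_(S : {set I} | ~~ (S \subset J)) coef t f S ^+ 2 <=
  (d%:R^-1 + 4 ^+ d * delta) * \sum_i influence t f i.
Proof.
move=> t12 d0 dpos bool_diff smallJ.
have t01 : 0 < t < 1 by move: t12 => /andP[? ?]; apply/andP; split; lra.
have t01' : 0 <= t <= 1 by move: t01 => /andP[? ?]; apply/andP; split; lra.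
have tt : 0 <= t * (1 - t) <= 1 by move: t01' => /andP[? ?]; apply/andP; split; nra.
have inf0 i : 0 <= influence t f i.
  by apply: expect_ge0 => // A; rewrite -bool_diff sqr_ge0.
pose low i (S : {set I}) : R := 4^-1 ^+ #|S| * coef t f S ^+ 2 *+ (i \in S).
have low0 i S : 0 <= low i S.
  by rewrite mulrn_wge0 // mulr_ge0 ?sqr_ge0 // exprn_ge0 // invr_ge0.
have c4 : 0 <= 4 ^+ d :> R by rewrite exprn_ge0.
(* Each [S] outside [J] is paid for by one of the two terms: if [d <= #|S|] the factor [#|S| / d] is
   at least 1; otherwise some [i] lies in [S] but not in [J], and [4 ^+ d] outweighs
   [4^-1 ^+ #|S|]. *)
apply: (@le_trans _ _ (\sum_(S : {set I}) (d%:R^-1 * (\sum_i coef t f S ^+ 2 *+ (i \in S)) +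
   4 ^+ d * \sum_(i | i \notin J) low i S))).
  rewrite big_mkcond; apply: ler_sum => S _.
  have cnt : \sum_i coef t f S ^+ 2 *+ (i \in S) = #|S|%:R * coef t f S ^+ 2.
    rewrite (eq_bigr (fun i => if i \in S then coef t f S ^+ 2 else 0)).
      by rewrite -big_mkcond sumr_const mulr_natl.
    by move=> i _; case: (i \in S).
  rewrite cnt; set c2 := coef t f S ^+ 2.
  have c20 : 0 <= c2 by rewrite sqr_ge0.
  have di0 : 0 <= d%:R^-1 * (#|S|%:R * c2).
    by apply: mulr_ge0; [rewrite invr_ge0 ler0n | rewrite mulr_ge0 ?ler0n].
  have lo0 : 0 <= 4 ^+ d * \sum_(i | i \notin J) low i S.
    by rewrite mulr_ge0 // sumr_ge0.
  case: ifPn => [|_]; last by rewrite addr_ge0.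
  move=> /subsetPn[i iS iJ]; have [dS|dS] := leqP d #|S|.
    rewrite -[leLHS]addr0 lerD // mulrA -[leLHS]mul1r ler_wpM2r //.
    by rewrite mulrC ler_pdivlMr ?ltr0n // mul1r ler_nat.
  rewrite -[leLHS]add0r lerD // (bigD1 i) //=.
  apply: (@le_trans _ _ (4 ^+ d * low i S)); last first.
    by apply: ler_wpM2l => //; rewrite lerDl sumr_ge0.
  rewrite /low iS mulr1n -/c2 mulrA -[leLHS]mul1r ler_wpM2r //.
  by rewrite exprVn -expfB // exprn_ege1 // ler1n.
rewrite big_split /= -!big_distrr /= mulrDl exchange_big [X in _ + _ * X]exchange_big /=.
have inf_sqr i : \sum_S coef t (diff f i) S ^+ 2 = influence t f i.
  by rewrite -parseval //; apply: eq_expect.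
apply: lerD.
  apply: ler_wpM2l; first by rewrite invr_ge0 ler0n.
  apply: ler_sum => i _.
  rewrite (_ : \sum_S _ = \sum_(S : {set I} | i \in S) 1 ^+ #|S| * coef t f S ^+ 2).
    rewrite sum_coef_diff // mulr1.
    under eq_bigr do rewrite expr1n mul1r.
    by rewrite inf_sqr ler_piMl //; case/andP: tt.
  rewrite [RHS]big_mkcond; apply: eq_bigr => S _.
  by rewrite expr1n mul1r; case: (i \in S).
rewrite -mulrA; apply: ler_wpM2l => //; rewrite big_distrr /= big_mkcond.
apply: ler_sum => i _; case: ifPn => iJ; last by rewrite mulr_ge0.
rewrite (_ : \sum_S _ =
  \sum_(S : {set I} | i \in S) 4^-1 ^+ #|S| * coef t f S ^+ 2); last first.
  by rewrite [RHS]big_mkcond; apply: eq_bigr => S _; rewrite /low; case: (i \in S).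
rewrite sum_coef_diff //.
have := small_support_noise t12 d0 (bool_diff i) (smallJ i iJ); rewrite -/(influence _ _ _).
have : 0 <= delta * influence t f i by rewrite mulr_ge0.
set x := \sum_(S : {set I}) _; have x0 : 0 <= x.
  by apply: sumr_ge0 => S _; rewrite mulr_ge0 ?sqr_ge0 // exprn_ge0 // invr_ge0.
by case/andP: tt; nra.
Qed.

(** * Up-sets *)

Definition indic (R : pzRingType) (I : finType) (G : {set {set I}}) (A : {set I}) : R :=
  (A \in G)%:R.

Definition mu (R : comPzRingType) (I : finType) (t : R) (G : {set {set I}}) : R :=
  expect t (indic R G).

Definition upset (I : finType) (G : {set {set I}}) : Prop :=
  forall A B : {set I}, A \subset B -> A \in G -> B \in G.

Lemma diff_indic_bool (R : pzRingType) (I : finType) (G : {set {set I}})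
    (i : I) (A : {set I}) :
  upset G -> diff (indic R G) i A ^+ 2 = diff (indic R G) i A.
Proof.
move=> upG; rewrite /diff /indic.
have := upG (A :\ i) (i |: A).
case: (A :\ i \in G); case: (i |: A \in G) => /= H;
  rewrite ?subrr ?subr0 ?expr0n ?expr1n //.
by have := H (subset_trans (subD1set _ _) (subsetUr _ _)) isT.
Qed.

(** Independent [p]- and [q]-biased sets meet in a [p * q]-biased set; coordinatewise independence
    shows this for point masses, and linearity extends it to [f]. *)
Lemma expect_setI (R : comPzRingType) (I : finType) (p q : R) (f : {set I} -> R) :
  expect (p * q) f = expect p (fun A => expect q (fun B => f (A :&: B))).
Proof.
have inter (C : {set I}) : expect p (fun A => expect q (fun B : {set I} => (A :&: B == C)%:R)) =
    weight (p * q) C.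
  pose g i a : R := q * ((a && true) == (i \in C))%:R +
                    (1 - q) * ((a && false) == (i \in C))%:R.
  rewrite (@eq_expect _ _ _ _ (fun A : {set I} => \prod_i g i (i \in A))).
    rewrite expect_prod; apply: eq_bigr => i _.
    by rewrite /g; case: (i \in C) => /=; ring.
  move=> A; rewrite /g -(expect_prod q (fun i b => ((i \in A) && b == (i \in C))%:R)).
  apply: eq_expect => B; rewrite -prod_mem_eq.
  by apply: eq_bigr => i _; rewrite inE.
rewrite /expect; under eq_bigr do rewrite -inter mulrC.
under eq_bigr => C _.
  rewrite -expectZ.
  under eq_expect do rewrite -expectZ.
  over.
rewrite /= -(expect_sum p) ; apply: eq_expect => A.
rewrite -(expect_sum q); apply: eq_expect => B.
rewrite (bigD1 (A :&: B)) //= eqxx mulr1 big1 ?addr0 // => C CAB.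
by rewrite eq_sym (negbTE CAB) mulr0.
Qed.

Lemma mu_ge0 (R : realFieldType) (I : finType) (t : R) (G : {set {set I}}) :
  0 <= t <= 1 -> 0 <= mu t G.
Proof. by move=> t01; apply: expect_ge0 => // A; rewrite /indic ler0n. Qed.

Lemma mu_le1 (R : realFieldType) (I : finType) (t : R) (G : {set {set I}}) :
  0 <= t <= 1 -> mu t G <= 1.
Proof.
move=> t01; rewrite -(expect_cst I t 1); apply: le_expect => // A.
by rewrite /indic; case: (_ \in _); rewrite ?ler01.
Qed.

Lemma le_mu (R : realFieldType) (I : finType) (t : R) (G H : {set {set I}}) :
  0 <= t <= 1 -> G \subset H -> mu t G <= mu t H.
Proof.
move=> t01 /subsetP GH; apply: le_expect => // A; rewrite /indic ler_nat.
by case AG: (A \in G) => //; rewrite GH.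
Qed.

(** If the intersection of two independent sets lies in the up-set, so do both sets. *)
Lemma mu_mul_le (R : realFieldType) (I : finType) (p q : R) (G : {set {set I}}) :
  0 <= p <= 1 -> 0 <= q <= 1 -> upset G -> mu (p * q) G <= mu p G * mu q G.
Proof.
move=> p01 q01 upG; rewrite /mu expect_setI [leRHS]mulrC -expectZ.
apply: le_expect => // A; rewrite mulrC -expectZ; apply: le_expect => // B.
rewrite /indic -natrM mulnb ler_nat; case AB: (A :&: B \in G) => //.
by rewrite (upG _ _ (subsetIl A B) AB) (upG _ _ (subsetIr A B) AB).
Qed.

Lemma mu_exp_le (R : realFieldType) (I : finType) (q : R) (m : nat)
    (G : {set {set I}}) :
  0 <= q <= 1 -> upset G -> mu (q ^+ m) G <= mu q G ^+ m.
Proof.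
move=> q01 upG; have qm k : 0 <= q ^+ k <= 1.
  by move: q01 => /andP[? ?]; rewrite exprn_ge0 // exprn_ile1.
elim: m => [|m IH]; first by rewrite !expr0 mu_le1 // ler01 lexx.
rewrite !exprS; apply: (le_trans (mu_mul_le q01 (qm m) upG)).
by apply: ler_wpM2l => //; apply: mu_ge0.
Qed.

(** Submultiplicativity for [s = (s / t) * t], with the first factor at most 1. *)
Lemma mu_homo (R : realFieldType) (I : finType) (s t : R) (G : {set {set I}}) :
  0 < s -> s <= t -> t <= 1 -> upset G -> mu s G <= mu t G.
Proof.
move=> s0 st t1 upG; have t0 : 0 < t by apply: lt_le_trans st.
have t01 : 0 <= t <= 1 by rewrite ltW.
have q01 : 0 <= s / t <= 1 by rewrite divr_ge0 ?ler_pdivrMr ?mul1r ?st // ltW.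
have := mu_mul_le q01 t01 upG; rewrite divfK ?gt_eqF // => /le_trans; apply.
by apply: ler_piMl; rewrite ?mu_ge0 ?mu_le1.
Qed.

(** Complementation preserves the unbiased measure, and [G] contains at most one of [A] and
    [~: A]. *)
Lemma mu_half_le (R : realFieldType) (I : finType) (G : {set {set I}}) :
  {in G &, forall A B, A :&: B != set0} -> mu (2^-1 : R) G <= 2^-1.
Proof.
move=> interG.
have half01 : 0 <= (2^-1 : R) <= 1 by apply/andP; split; lra.
have compl : mu (2^-1 : R) G = expect 2^-1 (fun A => indic R G (~: A)).
  rewrite /mu /expect (reindex_inj (inv_inj (@setCK I))); apply: eq_bigr => A _.
  congr (_ * _); apply: eq_bigr => i _; rewrite inE.
  by case: (i \in A) => /=; field.
have : mu (2^-1 : R) G + mu (2^-1 : R) G <= 1.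
  rewrite {2}compl -expectD -[leRHS](expect_cst I 2^-1); apply: le_expect => // A.
  rewrite /indic -natrD -[leRHS]/(1%:R) ler_nat; case AG: (A \in G); case CG: (~: A \in G) => //.
  by have := interG _ _ AG CG; rewrite setICr eqxx.
lra.
Qed.

(** * Russo's formula *)

Lemma deriv_prod (R : comNzRingType) (I : eqType) (s : seq I) (F : I -> {poly R}) :
  uniq s ->
  (\prod_(i <- s) F i)^`() = \sum_(i <- s) (F i)^`() * \prod_(j <- s | j != i) F j.
Proof.
elim: s => [|x s IH] /=; first by rewrite !big_nil -polyC1 derivC.
move=> /andP[xs us]; rewrite !big_cons derivM IH // eqxx /=; congr (_ * _ + _).
  rewrite [RHS]big_seq_cond [LHS]big_seq; apply: eq_bigl => j.
  by case js: (j \in s) => //=; apply/esym; apply: contraNneq xs => <-.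
rewrite big_distrr big_seq [RHS]big_seq; apply: eq_bigr => i si /=.
rewrite big_cons ifT; last by apply: contraNneq xs => ->.
by rewrite mulrCA.
Qed.

Lemma horner_prod_fin (R : comNzRingType) (I : finType) (P : pred I)
    (F : I -> {poly R}) (t : R) :
  (\prod_(i | P i) F i).[t] = \prod_(i | P i) (F i).[t].
Proof. exact: (big_morph (fun p => p.[t]) (fun p q => hornerM p q t) (hornerC 1 t)). Qed.

(** Under the formal bias ['X] the expectation is a polynomial, so the mean value theorem for
    polynomials becomes available. Pairing [A] with [i |: A] turns the signed sum from the product
    rule into the influence of [i]. *)
Lemma russo (R : comNzRingType) (I : finType) (f : {set I} -> R) :
  exists p : {poly R}, (forall t, p.[t] = expect t f) /\
    (forall t, p^`().[t] = \sum_i influence t f i).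
Proof.
exists (expect 'X (fun A => (f A)%:P)); split=> t.
  rewrite horner_sum; apply: eq_bigr => A _; rewrite hornerM hornerC.
  congr (_ * _); rewrite horner_prod_fin; apply: eq_bigr => i _.
  by case: ifP => _; rewrite ?hornerX // hornerD hornerN hornerC hornerX.
(* [v] is the weight without the factor of [i], and [sg] the derivative of that factor. *)
pose v i (A : {set I}) : R := \prod_(j | j != i) (if j \in A then t else 1 - t).
pose sg i (A : {set I}) : R := if i \in A then 1 else - 1.
transitivity (\sum_(A : {set I}) \sum_i sg i A * v i A * f A).
  rewrite linear_sum horner_sum; apply: eq_bigr => A _ /=.
  rewrite derivM derivC mulr0 addr0 hornerM hornerC -big_distrl /=.
  rewrite deriv_prod ?index_enum_uniq // horner_sum; congr (_ * _).
  apply: eq_bigr => i _; rewrite hornerM horner_prod_fin; congr (_ * _).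
    rewrite /sg; case: ifP => _; rewrite ?derivX ?hornerC //.
    by rewrite derivB derivC derivX sub0r hornerN hornerC.
  apply: eq_bigr => j _.
  by case: ifP => _; rewrite ?hornerX // hornerD hornerN hornerC hornerX.
rewrite exchange_big; apply: eq_bigr => i _ /=.
rewrite /influence /expect !(sum_set_split i xpredT) /=; apply: eq_bigr => A iA.
have vU : v i (i |: A) = v i A.
  by apply: eq_bigr => j /negbTE ji; rewrite !inE ji.
have wD B : weight t B = (if i \in B then t else 1 - t) * v i B.
  by rewrite /weight (bigD1 i).
rewrite /diff !wD vU /sg setU11 (negbTE iA).
have -> : i |: (i |: A) = i |: A by rewrite setUA setUid.
have -> : (i |: A) :\ i = A by apply: setU1K.
have -> : A :\ i = A by apply/setDidPl; rewrite disjoint_sym disjoints1.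
by ring.
Qed.

(** * Conditioning on the coordinates in a set *)

Lemma chi_mix (R : rcfType) (I : finType) (t : R) (S J A B : {set I}) :
  chi t S ((A :&: J) :|: (B :\: J)) = chi t (S :&: J) A * chi t (S :\: J) B.
Proof.
rewrite /chi (big_setID J) /=; congr (_ * _); apply: eq_bigr => i;
  by rewrite !inE => /andP[iS iJ]; rewrite ?iS ?iJ ?(negbTE iS) /= ?andbT ?andbF ?orbF.
Qed.

(** Each character splits into a part on [J] and a part outside; the latter averages to 0 unless it
    is empty. *)
Lemma conditional_fourier (R : rcfType) (I : finType) (t : R)
    (f : {set I} -> R) (J A : {set I}) :
  0 < t < 1 ->
  expect t (fun B => f ((A :&: J) :|: (B :\: J))) =
  \sum_(S : {set I}) (if S \subset J then coef t f S else 0) * chi t S A.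
Proof.
move=> t01; rewrite (@eq_expect _ _ _ _ (fun B =>
  \sum_S coef t f S * chi t (S :&: J) A * chi t (S :\: J) B)); last first.
  move=> B; rewrite (fourier f _ t01); apply: eq_bigr => S _.
  by rewrite chi_mix mulrA.
rewrite expect_sum; apply: eq_bigr => S _.
rewrite expectZ expect_chi // setD_eq0; case: ifP => SJ; last by rewrite mulr0 mul0r.
by rewrite mulr1 (setIidPl SJ).
Qed.

(* If the conclusion failed for the set [J] of influential elements, then by
   monotonicity the conditional expectation [fJ] of the indicator of [G] would
   be at least [eta] everywhere; its variance-like quantity [E fJ (1 - fJ)] is
   the Fourier weight outside [J], which is too small. *)
Lemma intersecting_capturable (R : rcfType) (I : finType) (eta delta : R)
    (d : nat) (G : {set {set I}}) :
  0 < delta -> (0 < d)%N -> (d%:R^-1 + 4 ^+ d * delta) * 2 < eta / 2 ->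
  upset G -> {in G &, forall A B, A :&: B != set0} ->
  exists J : {set I}, #|J|%:R * delta ^+ 2 <= 2 /\
    mu 4^-1 [set A | A :\: J \in G] < eta.
Proof.
move=> delta0 dpos small upG interG.
pose f := indic R G.
have [p [pE dpE]] := russo f.
have q_lt : (4^-1 : R) < 2^-1 by lra.
have [t] := poly_mvt p q_lt; rewrite in_itv /= => /andP[t1 t2].
have t12 : 4^-1 <= t <= 2^-1 by rewrite !ltW.
have t01 : 0 < t < 1 by apply/andP; split; lra.
have t01' : 0 <= t <= 1 by apply/andP; split; lra.
rewrite !pE dpE => mvtE.
(* The measure grows by at most 1/2 over an interval of length 1/4. *)
have total_le : \sum_i influence t f i <= 2.
  have : expect 2^-1 f <= 2^-1 by apply: mu_half_le.
  have : 0 <= expect 4^-1 f by apply: mu_ge0; apply/andP; split; lra.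
  by move: mvtE; set x := \sum_i _; lra.
have inf0 i : 0 <= influence t f i.
  by apply: expect_ge0 => // A; rewrite -diff_indic_bool // sqr_ge0.
pose J := [set i | delta ^+ 2 < influence t f i].
exists J; split.
  (* Each element of [J] contributes at least [delta ^+ 2] to the total influence. *)
  apply: le_trans total_le; rewrite mulr_natl -sumr_const big_mkcond.
  by apply: ler_sum => i _; rewrite inE; case: ifP => // /ltW.
rewrite ltNge; apply/negP => uncapt.
have weight_le : \sum_(S : {set I} | ~~ (S \subset J)) coef t f S ^+ 2 < eta / 2.
  apply: le_lt_trans small.
  apply: le_trans (friedgut_junta t12 (ltW delta0) dpos _ _) _.
  - by move=> i A; apply: diff_indic_bool.
  - by move=> i; rewrite inE -leNgt.
  by apply: ler_wpM2l => //; rewrite addr_ge0 ?invr_ge0 ?mulr_ge0 ?exprn_ge0 // ltW.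
pose c (S : {set I}) := if S \subset J then coef t f S else 0.
pose fJ A := \sum_S c S * chi t S A.
have fJE A : fJ A = expect t (fun B => f ((A :&: J) :|: (B :\: J))).
  by rewrite conditional_fourier.
(* If [B :\: J] is in [G], so is its union with [A :&: J], whatever [A] is. *)
have fJ_ge A : eta <= fJ A.
  apply: (le_trans uncapt); rewrite fJE.
  apply: (@le_trans _ _ (mu t [set A | A :\: J \in G])).
    apply: mu_homo; rewrite ?(ltW t1) //; [lra|lra|].
    by move=> A' B' AB; rewrite !inE; apply: upG; apply: setSD.
  apply: le_expect => // B; rewrite /indic inE ler_nat.
  by case BJ: (_ \in _) => //; rewrite (upG _ _ (subsetUr _ _) BJ).
have fJ_le A : fJ A <= 1.
  rewrite fJE -(expect_cst I t 1); apply: le_expect => // B.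
  by rewrite /f /indic; case: (_ \in _); rewrite ?ler01.
have f2 : expect t (fun A => f A ^+ 2) = expect t f.
  by apply: eq_expect => A; rewrite /f /indic; case: (_ \in _); rewrite ?expr1n ?expr0n.
have coef0 (g : {set I} -> R) : coef t g set0 = expect t g.
  by apply: eq_expect => A; rewrite chi0 mulr1.
have EfJ : expect t fJ = expect t f.
  by rewrite -coef0 coef_fourier // /c sub0set coef0.
have EfJ2 : expect t (fun A => fJ A ^+ 2) = \sum_S c S * c S.
  by rewrite -(expect_fourierM _ _ t01); apply: eq_expect => A; rewrite expr2.
have weightE : expect t f - \sum_S c S * c S =
    \sum_(S : {set I} | ~~ (S \subset J)) coef t f S ^+ 2.
  rewrite -f2 parseval // -sumrB [RHS]big_mkcond; apply: eq_bigr => S _.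
  by rewrite /c; case: (S \subset J) => /=; rewrite ?mulr0 ?subr0 // expr2 subrr.
(* The average of the pointwise bound [eta * (1 - fJ A) <= fJ A * (1 - fJ A)]. *)
have : eta * (1 - expect t f) <= expect t f - \sum_S c S * c S.
  rewrite -EfJ -EfJ2.
  have -> : eta * (1 - expect t fJ) = expect t (fun A => eta * (1 - fJ A)).
    rewrite expectZ; congr (_ * _).
    rewrite [RHS](@eq_expect _ _ _ _ (fun A => 1 + -1 * fJ A)); last first.
      by move=> A; rewrite mulN1r.
    by rewrite expectD expectZ expect_cst mulN1r.
  have -> : expect t fJ - expect t (fun A => fJ A ^+ 2) =
      expect t (fun A => fJ A * (1 - fJ A)).
    rewrite (@eq_expect _ _ _ (fun A => fJ A * (1 - fJ A))
      (fun A => fJ A + -1 * fJ A ^+ 2)); last first.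
      by move=> A; rewrite mulrBr mulr1 mulN1r expr2.
    by rewrite expectD expectZ mulN1r.
  by apply: le_expect => // A; apply: ler_wpM2r; rewrite ?subr_ge0.
have m_le : expect t f <= 2^-1.
  apply: le_trans (mu_half_le R interG).
  by apply: mu_homo => //; [lra | exact: ltW | lra].
have eta0 : 0 < eta.
  have : 0 <= (d%:R^-1 + 4 ^+ d * delta) * 2.
    by rewrite mulr_ge0 // addr_ge0 ?invr_ge0 ?mulr_ge0 ?exprn_ge0 // ltW.
  by move: small; set x := (_ * 2); lra.
(* As [f] has mean at most 1/2, the weight outside [J] is at least [eta / 2], a contradiction. *)
by rewrite weightE; move: weight_le; set x := \sum_(_ | _) _; nra.
Qed.

(** * From uniform families to biased measures *)

Definition upclosure (I : finType) (F : {set {set I}}) : {set {set I}} :=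
  [set A : {set I} | [exists B in F, B \subset A]].

Lemma upclosureP (I : finType) (F : {set {set I}}) (A : {set I}) :
  reflect (exists2 B, B \in F & B \subset A) (A \in upclosure F).
Proof. by rewrite inE; apply: exists_inP. Qed.

Lemma upset_upclosure (I : finType) (F : {set {set I}}) : upset (upclosure F).
Proof.
move=> A A' AA' /upclosureP[B BF BA]; apply/upclosureP; exists B => //.
exact: subset_trans AA'.
Qed.

Lemma weightE (R : comPzRingType) (I : finType) (t : R) (A : {set I}) :
  weight t A = t ^+ #|A| * (1 - t) ^+ (#|I| - #|A|).
Proof.
rewrite /weight big_if /= !prodr_const; congr (_ * _ ^+ _).
by rewrite -(cardC (mem A)) addKn.
Qed.

Lemma sum_card_subset (R : nmodType) (I : finType) (E : {set I}) (h : nat -> R) :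
  \sum_(D : {set I} | D \subset E) h #|D| = \sum_(m < #|E|.+1) h m *+ 'C(#|E|, m).
Proof.
rewrite (partition_big (fun D : {set I} => inord #|D| : 'I_#|E|.+1) xpredT) //=.
apply: eq_bigr => m _.
rewrite -cards_draws -sumr_const big_mkcond [RHS]big_mkcond; apply: eq_bigr => D _.
rewrite inE; case: ifP; case: ifP => //.
- move=> /andP[DE /eqP <-] /andP[_].
  by [].
- move=> H /andP[DE /eqP mE]; move: H; rewrite DE -mE inordK ?eqxx //.
  by rewrite ltnS subset_leq_card.
- by move=> /andP[DE /eqP ->]; rewrite DE inord_val eqxx.
Qed.

(** Write [A = B :|: D] with [D] disjoint from [B]. Only [#|B|] matters, so in a double count all
    sets of one size get the same share. *)
Lemma sum_superset (R : nmodType) (I : finType) (B : {set I}) (h : nat -> R) :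
  \sum_(A : {set I} | B \subset A) h #|A| =
  \sum_(m < (#|I| - #|B|).+1) h (#|B| + m)%N *+ 'C(#|I| - #|B|, m).
Proof.
have cB : #|~: B| = (#|I| - #|B|)%N by rewrite cardsCs setCK.
rewrite -cB -(sum_card_subset (~: B) (fun m => h (#|B| + m)%N)).
rewrite (reindex_onto (fun D => B :|: D) (fun A => A :\: B)) /=; last first.
  move=> A /subsetP BA; apply/setP => i; rewrite !inE.
  by case iB: (i \in B); rewrite //= BA.
have disjE D : ((B :|: D) :\: B == D) = (D \subset ~: B).
  by rewrite setDUl setDv set0U setDE; apply/eqP/setIidPl.
apply: eq_big => D; rewrite subsetUl disjE // => DB.
by rewrite cardsU (_ : B :&: D = set0) ?cards0 ?subn0 //; apply/eqP;
   rewrite setIC setI_eq0 disjoints_subset.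
Qed.

(** Chebyshev: the mean [x] is at least [2 * k], so a size below [k] deviates by at least [x / 2],
    which has probability at most [4 / x]; and [4 <= k] gives [8 <= x]. *)
Lemma expect_card_ge (R : rcfType) (I : finType) (p : R) (k : nat) :
  0 < p < 1 -> (4 <= k)%N -> k%:R * 2 <= #|I|%:R * p ->
  2^-1 <= expect p (fun A : {set I} => (k <= #|A|)%N%:R).
Proof.
move=> p01 k4 kn; have /andP[p0 p1] := p01.
have p01' : 0 <= p <= 1 by rewrite !ltW.
set n := #|I| in kn *.
have center (A : {set I}) :
    #|A|%:R - n%:R * p = stdev p * \sum_i chi p [set i] A.
  rewrite big_distrr /= (eq_bigr (fun i => (i \in A)%:R - p)); last first.
    move=> i _; rewrite /chi big_set1 /phi; field.
    by rewrite gt_eqF ?stdev_gt0.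
  rewrite sumrB sumr_const -/n mulr_natl; congr (_ - _).
  rewrite -sum1_card natr_sum big_mkcond; apply: eq_bigr => i _.
  by case: (i \in A).
have variance : expect p (fun A : {set I} => (#|A|%:R - n%:R * p) ^+ 2) =
    n%:R * (p * (1 - p)).
  rewrite (@eq_expect _ _ _ _ (fun A : {set I} => (p * (1 - p)) *
    \sum_i \sum_j chi p [set i] A * chi p [set j] A)); last first.
    move=> A; rewrite center exprMn stdev_sqr // expr2 big_distrl; congr (_ * _).
    by apply: eq_bigr => i _; rewrite big_distrr.
  rewrite expectZ mulrC expect_sum; congr (_ * _).
  rewrite (eq_bigr (fun _ => 1)); first by rewrite sumr_const.
  move=> i _; rewrite expect_sum (bigD1 i) //= expect_chiM // eqxx big1 ?addr0 //.
  by move=> j ji; rewrite expect_chiM // (inj_eq set1_inj) eq_sym (negbTE ji).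
have k4R : 4 <= k%:R :> R by rewrite ler_nat.
set x := n%:R * p in kn variance.
have x0 : 8 <= x by lra.
have tail : expect p (fun A : {set I} => 1 - (k <= #|A|)%N%:R) <=
    expect p (fun A : {set I} => 4 / x ^+ 2 * (#|A|%:R - x) ^+ 2).
  apply: le_expect => // A; case: leqP => [_|Ak]; rewrite ?subrr ?subr0.
    by rewrite mulr_ge0 ?sqr_ge0 // divr_ge0 ?sqr_ge0.
  rewrite mulrAC ler_pdivlMr ?mul1r; last by rewrite exprn_gt0 //; lra.
  have : #|A|%:R <= k%:R :> R by rewrite ler_nat ltnW.
  have : 0 <= #|A|%:R :> R by rewrite ler0n.
  by set y := _%:R; nra.
have tail_le : 4 / x ^+ 2 * (n%:R * (p * (1 - p))) <= 2^-1.
  rewrite mulrA -/x mulrAC ler_pdivrMr; last by rewrite exprn_gt0 //; lra.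
  by rewrite mulrA -/x; nra.
move: tail; rewrite expectZ variance.
rewrite (@eq_expect _ _ _ _ (fun A : {set I} => 1 + -1 * (k <= #|A|)%N%:R)); last first.
  by move=> A; rewrite mulN1r.
by rewrite expectD expectZ expect_cst; lra.
Qed.

(* Local LYM: the members of [F] are shared out evenly among their supersets of
   each given size. *)
Lemma mu_upclosure_ge (R : rcfType) (I : finType) (p : R) (k : nat)
    (F : {set {set I}}) :
  0 < p < 1 -> (4 <= k)%N -> k%:R * 2 <= #|I|%:R * p ->
  (forall A, A \in F -> #|A| = k) ->
  #|F|%:R <= 2 * 'C(#|I|, k)%:R * mu p (upclosure F).
Proof.
move=> p01 k4 kn Fk; have p01' : 0 <= p <= 1 by case/andP: p01 => *; rewrite !ltW.
(* The weight of an [m]-set shared equally among its [k]-subsets (0 for [m < k], by division by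
   zero); [c] is the total share of one [k]-set. *)
pose h m : R := p ^+ m * (1 - p) ^+ (#|I| - m) / 'C(m, k)%:R.
pose c : R := \sum_(m < (#|I| - k).+1) h (k + m)%N *+ 'C(#|I| - k, m).
have cE (B : {set I}) : #|B| = k -> \sum_(A : {set I} | B \subset A) h #|A| = c.
  by move=> Bk; rewrite sum_superset Bk.
have h0 m : 0 <= h m.
  by rewrite divr_ge0 // mulr_ge0 // exprn_ge0 //; case/andP: p01' => *; lra.
have count (G : {set {set I}}) : (forall A, A \in G -> #|A| = k) ->
    #|G|%:R * c = \sum_(A : {set I}) h #|A| * #|[set B in G | B \subset A]|%:R.
  move=> Gk; rewrite mulr_natl -sumr_const.
  rewrite (eq_bigr (fun B : {set I} => \sum_(A : {set I} | B \subset A) h #|A|)).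
    rewrite (exchange_big_dep xpredT) //=; apply: eq_bigr => A _.
    rewrite mulr_natr -sumr_const; apply: eq_bigl => B.
    by rewrite !inE.
  by move=> B BG; rewrite cE // Gk.
(* Counting with all [k]-sets evaluates [c]. *)
have binc : 'C(#|I|, k)%:R * c = expect p (fun A : {set I} => (k <= #|A|)%N%:R).
  rewrite -card_draws count; last by move=> A; rewrite inE => /eqP.
  apply: eq_bigr => A _; rewrite weightE.
  rewrite (_ : [set B in _ | _] = [set B : {set I} | B \subset A & #|B| == k]).
    rewrite cards_draws /h; case: (leqP k #|A|) => kA.
      by rewrite divfK ?mulr1 // pnatr_eq0 -lt0n bin_gt0.
    by rewrite bin_small // !mulr0.
  by apply/setP => B; rewrite !inE andbC.
have Fc : #|F|%:R * c <= mu p (upclosure F).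
  rewrite count //; apply: ler_sum => A _; rewrite weightE /indic.
  case AF: (A \in upclosure F); last first.
    rewrite (_ : [set B in F | _] = set0) ?cards0 ?mulr0 //.
    apply/setP => B; rewrite !inE; apply: contraFF AF => /andP[BF BA].
    by apply/upclosureP; exists B.
  have kA : (k <= #|A|)%N.
    by have /upclosureP[B BF BA] := AF; rewrite -(Fk _ BF) subset_leq_card.
  rewrite /h mulr1 mulrAC ler_pdivrMr ?ltr0n ?bin_gt0 //.
  apply: ler_wpM2l; first by rewrite mulr_ge0 // exprn_ge0 //; case/andP: p01' => *; lra.
  rewrite ler_nat -cards_draws; apply: subset_leq_card; apply/subsetP => B.
  by rewrite !inE => /andP[BF ->]; rewrite Fk ?eqxx.
have half := expect_card_ge p01 k4 kn; rewrite -binc in half.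
have F0 : 0 <= #|F|%:R :> R by rewrite ler0n.
have C0 : 0 <= 'C(#|I|, k)%:R :> R by rewrite ler0n.
set f : R := #|F|%:R in F0 Fc *; set b : R := 'C(_, _)%:R in half C0 *.
have : f * 2^-1 <= f * (b * c) by apply: ler_wpM2l.
have : b * (f * c) <= b * mu p (upclosure F) by apply: ler_wpM2l.
by rewrite mulrCA -mulrA; lra.
Qed.

(** Lowering both arguments by one divides the binomial by [(n - r) / (k - r)], which is at most
    [2 * n / k] as long as [k - r] is at least [k / 2]. *)
Lemma bin_sub_ge (n k r : nat) :
  (r * 2 <= k)%N -> (k <= n)%N ->
  ('C(n, k) * k ^ r <= 'C(n - r, k - r) * (2 * n) ^ r)%N.
Proof.
move=> rk kn; elim: r rk => [|r IH] rk; first by rewrite !subn0.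
have rk' : (r * 2 <= k)%N by apply: leq_trans rk; rewrite leq_mul2r leqnSn orbT.
have step : ('C(n - r, k - r) * k <= 'C(n - r.+1, k - r.+1) * (2 * n))%N.
  have := mul_bin_diag (n - r) (k - r.+1).
  rewrite -subnS (_ : (k - r.+1).+1 = k - r)%N; last by rewrite subnSK //; lia.
  have : (k <= 2 * (k - r))%N by lia.
  have : (n - r <= n)%N by lia.
  set x := 'C(_, _); set y := 'C(_, _); nia.
by have := IH rk'; rewrite !expnSr; nia.
Qed.

(** * Irregular families *)

Lemma sum_degree (n : nat) (F : {set {set 'I_n}}) (J : {set 'I_n}) :
  (\sum_(x in J) degree F x = \sum_(A in F) #|A :&: J|)%N.
Proof.
transitivity (\sum_(x in J) \sum_(A in F | x \in A) 1)%N.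
  by apply: eq_bigr => x _; rewrite sum1_card; apply: eq_card => A; rewrite !inE.
rewrite (exchange_big_dep (mem F)) /=; last by move=> x A _ /andP[].
apply: eq_bigr => A AF; rewrite -sum1_card; apply: eq_bigl => x.
by rewrite !inE AF andbC.
Qed.

Lemma min_degree_le (n : nat) (F : {set {set 'I_n}}) (x : 'I_n) :
  (min_degree F <= degree F x)%N.
Proof.
rewrite /min_degree; have : x \in index_enum 'I_n by apply: mem_index_enum.
elim: (index_enum _) => // y s IH; rewrite inE big_cons => /orP[/eqP <-|xs].
  exact: geq_minl.
by apply: leq_trans (geq_minr _ _) (IH xs).
Qed.

(** The minimal degree is at most the average degree [k * #|F| / n]. *)
Lemma max_degree_bound (R : realType) (alpha : R) (n k : nat)
    (F : {set {set 'I_n}}) :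
  0 <= alpha -> uniform_family k F -> irregular alpha F ->
  n%:R * (max_degree F)%:R <= alpha * (k%:R * #|F|%:R).
Proof.
move=> a0 Fk irr; apply: (@le_trans _ _ (n%:R * (alpha * (min_degree F)%:R))).
  by apply: ler_wpM2l; rewrite ?ler0n.
rewrite mulrCA; apply: ler_wpM2l => //; rewrite -!natrM ler_nat.
have -> : (k * #|F| = \sum_(x in [set: 'I_n]) degree F x)%N.
  rewrite sum_degree mulnC -sum_nat_const; apply: eq_bigr => A AF.
  by rewrite setIT Fk.
rewrite -[X in (X * _)%N]card_ord -cardsT -sum_nat_const.
by apply: leq_sum => x _; apply: min_degree_le.
Qed.

(** Union bound, meant both for a junta [J] and for a member [J] of the family. *)
Lemma card_hitting (n : nat) (F : {set {set 'I_n}}) (J : {set 'I_n}) :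
  (#|[set A in F | A :&: J != set0]| <= #|J| * max_degree F)%N.
Proof.
apply: (@leq_trans (\sum_(x in J) degree F x)); last first.
  rewrite -sum_nat_const; apply: leq_sum => x _.
  exact: (leq_bigmax_cond (F := degree F)).
rewrite sum_degree -sum1_card big_mkcond [leqRHS]big_mkcond; apply: leq_sum => A _.
rewrite inE; case: (A \in F) => //=.
by rewrite -card_gt0; case: #|_|.
Qed.

Theorem theorem10 (R : realType) (r : nat) (alpha : R)
    (hr : (0 < r)%N) (halpha : 1 <= alpha) :
  exists C : R, forall n k : nat, (0 < n)%N -> (0 < k)%N -> C * k%:R < n%:R ->
    forall F : {set {set 'I_n}},
      uniform_family k F -> intersecting F -> irregular alpha F ->
      #|F|%:R <= C * (bin_shift n k r)%:R.
Proof.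
have a0 : 0 < alpha by apply: lt_le_trans halpha.
(* Chosen so that [d%:R^-1 = eta / 8] and [4 ^+ d * delta = eta / 16]; twice their sum is below
   [eta / 2]. *)
pose d := (8 * 4 ^ r)%N; pose eta : R := 4^-1 ^+ r.
have eta0 : 0 < eta by rewrite exprn_gt0 // invr_gt0.
pose delta : R := eta / (16 * 4 ^+ d).
have d4 : 0 < 4 ^+ d :> R by rewrite exprn_gt0.
have delta0 : 0 < delta by rewrite divr_gt0 // mulr_gt0.
have dpos : (0 < d)%N by rewrite muln_gt0 expn_gt0.
have dE : d%:R^-1 = eta / 8.
  rewrite /d /eta natrM natrX exprVn; field.
  by rewrite expf_neq0 // pnatr_eq0.
have small : (d%:R^-1 + 4 ^+ d * delta) * 2 < eta / 2.
  rewrite dE (_ : 4 ^+ d * delta = eta / 16); first by lra.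
  by rewrite /delta; field; rewrite gt_eqF.
(* [c1] makes the junta miss half of [F], [c2] forces [k] to be large, [c3] serves the final count,
   and the summand 8 below ensures [p < 1]. *)
pose c1 := 4 * alpha / delta ^+ 2; pose c2 := alpha * (r * 2 + 4)%:R.
pose c3 : R := 4 * 16 ^+ r.
have c10 : 0 < c1 by rewrite divr_gt0 ?exprn_gt0 // mulr_gt0.
have c20 : 0 < c2 by rewrite mulr_gt0 // ltr0n addnC.
have c30 : 0 < c3 by rewrite mulr_gt0 // exprn_gt0.
exists (c1 + c2 + c3 + 8) => n k n0 k0 Ckn F Fk interF irr.
set C := c1 + c2 + c3 + 8 in Ckn *.
have C0 : 0 < C by rewrite /C; lra.
have n0R : 0 < n%:R :> R by rewrite ltr0n.
have k0R : 0 < k%:R :> R by rewrite ltr0n.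
have [->|[A0 A0F]] := set_0Vmem F; first by rewrite cards0 mulr_ge0 ?ler0n // ltW.
have F0 : 0 < #|F|%:R :> R by rewrite ltr0n; apply/card_gt0P; exists A0.
have kn : (k <= n)%N by rewrite -(Fk _ A0F) -[leqRHS]card_ord max_card.
have degM := max_degree_bound (ltW a0) Fk irr.
have Fmax : (#|F| <= k * max_degree F)%N.
  rewrite -{1}(Fk _ A0F); apply: leq_trans (card_hitting F A0).
  apply: subset_leq_card; apply/subsetP => A AF.
  by rewrite inE AF interF.
(* All members of [F] meet [A0], so some degree is at least [#|F| / k]; together with [C * k < n]
   this excludes small [k]. *)
have nk2 : n%:R <= alpha * k%:R ^+ 2.
  rewrite -(ler_pM2r F0).
  apply: (@le_trans _ _ (n%:R * (k%:R * (max_degree F)%:R))).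
    by apply: ler_wpM2l; rewrite ?ler0n // -natrM ler_nat.
  rewrite mulrCA [leRHS](_ : _ = k%:R * (alpha * (k%:R * #|F|%:R))); last by ring.
  by apply: ler_wpM2l; first exact: ltW.
have k_gt : (r * 2 + 4 < k)%N.
  rewrite -(ltr_nat R) -(ltr_pM2l a0) -/c2 -(ltr_pM2r k0R).
  apply: (@lt_le_trans _ _ n%:R); last by rewrite -mulrA -expr2.
  apply: le_lt_trans Ckn; apply: ler_wpM2r; first exact: ltW.
  by rewrite /C; lra.
have rk : (r * 2 <= k)%N by apply: leq_trans (leq_addr _ _) (ltnW k_gt).
have rk' : (r <= k)%N by apply: leq_trans (leq_pmulr _ _) rk.
rewrite /bin_shift rk'.
have nk8 : (8 * k <= n)%N.
  rewrite -(ler_nat R) natrM; apply: le_trans (ltW Ckn).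
  by apply: ler_wpM2r; [exact: ltW | rewrite /C; lra].
(* [p = 4^-m] is the least power of 1/4 with [2 * k <= n * p]: large enough for local LYM, within a
   constant factor of [k / n], and comparable with bias 1/4. *)
pose q := (n %/ (2 * k))%N; pose m := trunc_log 4 q.
have k2 : (0 < 2 * k)%N by rewrite muln_gt0.
have q4 : (4 <= q)%N by rewrite /q leq_divRL // mulnA.
have m0 : (0 < m)%N by rewrite trunc_log_gt0.
have q0 : (0 < q)%N by apply: leq_trans q4.
have mle : (4 ^ m * (2 * k) <= n)%N by rewrite -leq_divRL // trunc_logP.
have mlt : (n < 4 ^ m.+1 * (2 * k))%N by rewrite -ltn_divLR // trunc_log_ltn.
pose p : R := 4^-1 ^+ m.
have p0 : 0 < p by rewrite exprn_gt0 // invr_gt0.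
have p1 : p < 1 by rewrite exprn_ilt1 ?invf_lt1 ?ltr1n // -?lt0n ?invr_ge0.
have pE : p * (4 ^ m)%:R = 1.
  by rewrite /p natrX -exprMn mulVf ?expr1n // pnatr_eq0.
have np : k%:R * 2 <= #|'I_n|%:R * p.
  rewrite card_ord (_ : k%:R * 2 = p * (4 ^ m * (2 * k))%:R); last first.
    by rewrite !natrM mulrA pE mul1r mulrC.
  by rewrite mulrC; apply: ler_wpM2r; rewrite ?ler_nat // ltW.
have kp : p / 16 <= k%:R / (2 * n)%:R.
  rewrite ler_pdivlMr ?ltr0n ?muln_gt0 ?n0 //.
  have : n%:R <= (4 ^ m.+1 * (2 * k))%:R :> R by rewrite ler_nat ltnW.
  rewrite expnS !natrM => /(ler_wpM2l (ltW p0)).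
  rewrite [X in _ <= X -> _](_ : _ = p * (4 ^ m)%:R * (8 * k%:R)); last by ring.
  by rewrite pE; lra.
rewrite leNgt; apply/negP => Fbig.
pose G := upclosure F.
have upG : upset G by apply: upset_upclosure.
have interG : {in G &, forall A B, A :&: B != set0}.
  move=> A B /upclosureP[A' A'F AA] /upclosureP[B' B'F BB].
  have := interF _ _ A'F B'F; apply: contraNneq => AB.
  by rewrite -subset0 -AB setISS.
have [J [cardJ muJ]] := intersecting_capturable delta0 dpos small upG interG.
pose FJ := [set A in F | A :&: J == set0].
have FJ_half : #|F|%:R <= 2 * #|FJ|%:R :> R.
  have split_F : (#|F| <= #|FJ| + #|J| * max_degree F)%N.
    rewrite -(cardsID [set A : {set 'I_n} | A :&: J == set0] F) leq_add //.
      by apply: subset_leq_card; apply/subsetP => A; rewrite !inE.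
    apply: leq_trans (card_hitting F J).
    by apply: subset_leq_card; apply/subsetP => A; rewrite !inE andbC.
  have hit : #|J|%:R * (max_degree F)%:R <= #|F|%:R / 2 :> R.
    rewrite -(ler_pM2r n0R) -mulrA [_ * n%:R]mulrC.
    apply: (@le_trans _ _ (2 / delta ^+ 2 * (alpha * (k%:R * #|F|%:R)))).
      apply: ler_pM; rewrite ?mulr_ge0 ?ler0n //.
      by rewrite ler_pdivlMr ?exprn_gt0.
    rewrite (_ : _ * _ = #|F|%:R / 2 * (c1 * k%:R)); last first.
      by rewrite /c1; field; rewrite gt_eqF.
    apply: ler_wpM2l; first by rewrite divr_ge0 // ltW.
    apply: le_trans (ltW Ckn); apply: ler_wpM2r; first exact: ltW.
    by rewrite /C; lra.
  have : #|F|%:R <= #|FJ|%:R + #|J|%:R * (max_degree F)%:R :> R.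
    by rewrite -natrM -natrD ler_nat.
  by lra.
pose H := [set A | A :\: J \in G].
have upH : upset H.
  by move=> A B AB; rewrite in_set => AH; rewrite in_set; apply: upG AH; apply: setSD.
have FJH : upclosure FJ \subset H.
  apply/subsetP => A /upclosureP[B]; rewrite !inE => /andP[BF BJ] BA.
  by apply/exists_inP; exists B; rewrite // subsetD BA -setI_eq0.
have p01 : 0 < p < 1 by rewrite p0.
have FJk A : A \in FJ -> #|A| = k by rewrite inE => /andP[/Fk].
have lym := mu_upclosure_ge p01 (leq_trans _ (ltnW k_gt)) np FJk.
have {lym} : #|FJ|%:R <= 2 * 'C(n, k)%:R * p ^+ r.
  rewrite card_ord in lym; apply: le_trans (lym (leq_addl _ _)) _.
  apply: ler_wpM2l; first by rewrite mulr_ge0.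
  apply: (@le_trans _ _ (mu p H)); first by apply: le_mu => //; rewrite !ltW.
  have quarter : 0 <= (4^-1 : R) <= 1 by apply/andP; split; lra.
  (* [mu p H] is at most the [m]-th power of [mu 4^-1 H], hence at most [eta ^+ m = p ^+ r]. *)
  apply: (le_trans (mu_exp_le _ quarter upH)).
  rewrite /p -exprM mulnC exprM; apply: lerXn2r; rewrite ?nnegrE ?mu_ge0 ?(ltW eta0) //.
  exact: ltW.
have binR : 'C(n, k)%:R * (p / 16) ^+ r <= 'C(n - r, k - r)%:R :> R.
  apply: (@le_trans _ _ ('C(n, k)%:R * (k%:R / (2 * n)%:R) ^+ r)).
    apply: ler_wpM2l; rewrite ?ler0n // lerXn2r ?nnegrE ?divr_ge0 //.
    exact: ltW.
  rewrite expr_div_n mulrA ler_pdivrMr; last by rewrite exprn_gt0 // ltr0n muln_gt0.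
  by rewrite -!natrX -!natrM ler_nat bin_sub_ge.
(* This contradicts [#|F| <= 2 * #|FJ| <= 4 * 'C(n, k) * p ^+ r], whose right side is
   [c3 * 'C(n, k) * (p / 16) ^+ r]. *)
have : C * ('C(n, k)%:R * (p / 16) ^+ r) < #|F|%:R.
  by apply: le_lt_trans Fbig; apply: ler_wpM2l; rewrite // ltW.
have : c3 * ('C(n, k)%:R * (p / 16) ^+ r) <= C * ('C(n, k)%:R * (p / 16) ^+ r).
  apply: ler_wpM2r; last by rewrite /C; lra.
  by rewrite mulr_ge0 // exprn_ge0 // divr_ge0 // ltW.
rewrite (_ : c3 * _ = 4 * ('C(n, k)%:R * p ^+ r)); last first.
  by rewrite /c3 expr_div_n; field; rewrite expf_neq0 // pnatr_eq0.
by rewrite -mulrA; lra.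
Qed.
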